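(* Let $G_1,G_2$ be finite groups, $k_1,k_2\ge 0$, $0\le i\le \min(k_1,k_2)$, and let $L$ be an $i$-unigen $(G_1^{*k_1},G_2^{*k_2})$-bimodule, with $L_i=e_i\cdot L=L\cdot f_i$. Then there exists an isomorphism $G_1\simeq G_2$ such that $L_i\simeq G_1^{*i}$ as $(G_1^{*k_1},G_2^{*k_2})$-bimodules, where $G_2^{*k_2}$ acts on the right of $G_1^{*i}$ through this isomorphism. If $i>0$ the isomorphism $G_1\simeq G_2$ with this property is unique. If $i=0$ the isomorphism is well defined up to inner automorphisms.
   Context: For a group $G$ with identity $e_0$ and $k\ge 0$, $G^{*k}$ is the monoid $G\sqcup\{e_1,\dots,e_k\}$ whose multiplication extends that of $G$, with $e_j g=g e_j=g$ for $g\in G$ and $e_j e_l=e_{\min(j,l)}$; its identity is $e_k$. For $i\le k$, $G^{*i}$ is viewed as the subset $G\cup\{e_1,\dots,e_i\}$ (a two-sided ideal) of $G^{*k}$, so $G^{*k}$ acts on $G^{*i}$ on both sides by multiplication. Write $e_0,\dots,e_{k_1}$ for the idempotents of $G_1^{*k_1}$ and $f_0,\dots,f_{k_2}$ for those of $G_2^{*k_2}$ ($e_0,f_0$ the group identities). An $(A,B)$-bimodule for monoids $A,B$ is a set with a left unital $A$-action and a right unital $B$-action that commute. For $i\le k_1,k_2$, a $(G_1^{*k_1},G_2^{*k_2})$-bimodule $L$ is $i$-unigen if $L\cdot f_i=e_i\cdot L=:L_i$ and $L_i\simeq G_1^{*i}$ as a left $G_1^{*k_1}$-module and $L_i\simeq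 G_2^{*i}$ as a right $G_2^{*k_2}$-module. An isomorphism $\phi:G_1\to G_2$ extends to $G_1^{*i}\simeq G_2^{*i}$ by $e_j\mapsto f_j$; the right action of $G_2^{*k_2}$ on $G_1^{*i}$ through $\phi$ is the one transported by this extension from the right multiplication action of $G_2^{*k_2}$ on $G_2^{*i}$. *)

(* Defs.v *)
From HB Require Import structures.
From mathcomp Require Import all_boot all_fingroup.
From mathcomp Require Import classical_sets functions.

Set Implicit Arguments.
Unset Strict Implicit.
Unset Printing Implicit Defensive.

Local Open Scope group_scope.

(* The monoid G^{*k}. The adjoined idempotents e_1, ..., e_k are numbered
   from 0: [GIdem j] is e_(j+1). *)
Variant gstar (G : groupType) (k : nat) : Type :=
  | GElt of G
  | GIdem of 'I_k.

Arguments GElt {G k} _.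
Arguments GIdem {G k} _.

Definition min_ord (k i : nat) (j : 'I_k) (l : 'I_i) : 'I_i :=
  Ordinal (leq_ltn_trans (geq_minr j l) (ltn_ord l)).

Section Gstar.
Variable G : groupType.

Definition sum_of_gstar (k : nat) (a : gstar G k) : G + 'I_k :=
  match a with GElt g => inl g | GIdem j => inr j end.

Definition gstar_of_sum (k : nat) (a : G + 'I_k) : gstar G k :=
  match a with inl g => GElt g | inr j => GIdem j end.

Lemma sum_of_gstarK (k : nat) :
  cancel (@sum_of_gstar k) (@gstar_of_sum k).
Proof. by case. Qed.

HB.instance Definition _ (k : nat) :=
  Choice.copy (gstar G k) (can_type (@sum_of_gstarK k)).

Definition gstar_mul (k : nat) (a b : gstar G k) : gstar G k :=
  match a, b with
  | GElt g, GElt h => GElt (g * h)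
  | GElt g, GIdem _ => GElt g
  | GIdem _, GElt h => GElt h
  | GIdem j, GIdem l => GIdem (min_ord j l)
  end.

(* e_j for 0 <= j <= k, where e_0 is the identity of G. *)
Definition gidem (k : nat) (j : 'I_k.+1) : gstar G k :=
  if unlift ord0 j is Some j' then GIdem j' else GElt 1.

Lemma gstar_mulA (k : nat) : associative (@gstar_mul k).
Proof.
move=> [g|j] [h|l] [m|n] //=; first by rewrite mulgA.
by congr GIdem; apply: val_inj; rewrite /= minnA.
Qed.

Lemma gstar_mul1g (k : nat) : left_id (gidem ord_max) (@gstar_mul k).
Proof.
move=> x; rewrite /gidem; case: unliftP => [j|] /(congr1 val) /=.
  rewrite /bump add1n; case: x => //= l Ek.
  congr GIdem; apply: val_inj; apply/minn_idPr => /=.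
  by rewrite -ltnS -Ek.
move=> Ek; case: x => [g|l] /=; first by rewrite mul1g.
by case: l => l; rewrite Ek.
Qed.

Lemma gstar_mulg1 (k : nat) : right_id (gidem ord_max) (@gstar_mul k).
Proof.
move=> x; rewrite /gidem; case: unliftP => [j|] /(congr1 val) /=.
  rewrite /bump add1n; case: x => //= l Ek.
  congr GIdem; apply: val_inj; apply/minn_idPl => /=.
  by rewrite -ltnS -Ek.
move=> Ek; case: x => [g|l] /=; first by rewrite mulg1.
by case: l => l; rewrite Ek.
Qed.

HB.instance Definition _ (k : nat) :=
  isMonoid.Build (gstar G k)
    (@gstar_mulA k) (@gstar_mul1g k) (@gstar_mulg1 k).

Definition gstar_incl (i k : nat) (leik : i <= k) (x : gstar G i) :
    gstar G k :=
  match x with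
  | GElt g => GElt g
  | GIdem l => GIdem (widen_ord leik l)
  end.

(* The actions of G^{*k} on its two-sided ideal G^{*i}, for i <= k: they are
   multiplication in G^{*k}, see [gstar_incl_lact] and [gstar_incl_ract]. *)
Definition gstar_lact (k i : nat) (a : gstar G k) (x : gstar G i) :
    gstar G i :=
  match a, x with
  | GElt g, GElt h => GElt (g * h)
  | GElt g, GIdem _ => GElt g
  | GIdem _, GElt h => GElt h
  | GIdem j, GIdem l => GIdem (min_ord j l)
  end.

Definition gstar_ract (k i : nat) (x : gstar G i) (b : gstar G k) :
    gstar G i :=
  match x, b with
  | GElt g, GElt h => GElt (g * h)
  | GElt g, GIdem _ => GElt g
  | GIdem _, GElt h => GElt h
  | GIdem l, GIdem j => GIdem (min_ord j l)
  end.

Lemma gstar_incl_inj (i k : nat) (leik : i <= k) :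
  injective (gstar_incl leik).
Proof. by move=> [g|l] [h|m] //= [] => [->|/val_inj ->]. Qed.

Lemma gstar_incl_lact (i k : nat) (leik : i <= k)
    (a : gstar G k) (x : gstar G i) :
  gstar_incl leik (gstar_lact a x) = a * gstar_incl leik x.
Proof.
by case: a x => [g|j] [h|l] //; congr GIdem; apply: val_inj.
Qed.

Lemma gstar_incl_ract (i k : nat) (leik : i <= k)
    (x : gstar G i) (b : gstar G k) :
  gstar_incl leik (gstar_ract x b) = gstar_incl leik x * b.
Proof.
by case: x b => [g|j] [h|l] //; congr GIdem; apply: val_inj; rewrite /= minnC.
Qed.

Lemma gstar_incl_idem (i k : nat) (leik : i <= k) (j : nat) :
  j <= i -> gstar_incl leik (gidem (inord j)) = gidem (inord j).
Proof.
move=> leji; have lejk := leq_trans leji leik.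
rewrite /gidem; case: unliftP => [l|] /(congr1 val); rewrite /= inordK //;
  case: unliftP => [m|] /(congr1 val); rewrite /= inordK //; last by move=> -> .
  rewrite /bump !add1n => -> [] Elm; congr GIdem; exact: val_inj.
by move=> ->.
Qed.
End Gstar.

Definition gstar_map (G H : groupType) (f : G -> H) (i : nat)
    (x : gstar G i) : gstar H i :=
  match x with
  | GElt g => GElt (f g)
  | GIdem l => GIdem l
  end.

Record bimodule (A B : monoidType) := Bimodule {
  bimod_car :> Type;
  lact : A -> bimod_car -> bimod_car;
  ract : bimod_car -> B -> bimod_car;
  lact1 : forall x, lact 1 x = x;
  lactM : forall a b x, lact (a * b) x = lact a (lact b x);
  ract1 : forall x, ract x 1 = x;
  ractM : forall x a b, ract x (a * b) = ract (ract x a) b;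
  lractA : forall a x b, lact a (ract x b) = ract (lact a x) b
}.

(* [psi] is an isomorphism of left (resp. right) modules from [M] onto the
   subset [S] of [L], [S] being stable under the action. *)
Definition left_iso (A M L : Type) (actM : A -> M -> M) (actL : A -> L -> L)
    (S : set L) (psi : M -> L) : Prop :=
  set_bij [set: M]%classic S psi /\ forall a x, psi (actM a x) = actL a (psi x).

Definition right_iso (B M L : Type) (actM : M -> B -> M) (actL : L -> B -> L)
    (S : set L) (psi : M -> L) : Prop :=
  set_bij [set: M]%classic S psi /\ forall x b, psi (actM x b) = actL (psi x) b.

Section Unigen.
Variables (G1 G2 : finGroupType) (k1 k2 i : nat).
Variable L : bimodule (gstar G1 k1) (gstar G2 k2).

(* L_i = e_i . L; here and below [inord i] is i itself provided that
   i <= k1 (resp. i <= k2). *)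
Definition unigen_part : set L :=
  range (fun x : L => lact (gidem G1 (inord i : 'I_k1.+1)) x).

Definition unigen : Prop :=
  [/\ range (fun x : L => ract x (gidem G2 (inord i : 'I_k2.+1)))
        = unigen_part,
      exists psi : gstar G1 i -> L,
        left_iso (@gstar_lact G1 k1 i) (@lact _ _ L) unigen_part psi &
      exists psi : gstar G2 i -> L,
        right_iso (@gstar_ract G2 k2 i) (@ract _ _ L) unigen_part psi].

(* The right action of G2^{*k2} on G1^{*i} through the isomorphism [phi]. *)
Definition ract_through (phi : {morphism [set: G1] >-> G2})
    (isophi : isom [set: G1] [set: G2] phi)
    (x : gstar G1 i) (b : gstar G2 k2) : gstar G1 i :=
  gstar_map (isom_inv isophi) (gstar_ract (gstar_map phi x) b).

(* [phi] is an isomorphism of groups, and L_i is isomorphic to G1^{*i} as a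
   bimodule, where G2^{*k2} acts on G1^{*i} through [phi]. *)
Definition iso_through (phi : {morphism [set: G1] >-> G2}) : Prop :=
  exists (isophi : isom [set: G1] [set: G2] phi) (psi : gstar G1 i -> L),
    left_iso (@gstar_lact G1 k1 i) (@lact _ _ L) unigen_part psi /\
    right_iso (ract_through isophi) (@ract _ _ L) unigen_part psi.
End Unigen.

(* Main.v *)
(* Let [u] generate [L_i] as a left module. Since the actions commute, acting
   by [b] on the right amounts, through [psi1 : G1^{*i} -> L_i], to right
   multiplication by the element [rho b] with [psi1 (rho b) = u . b]. Then
   [rho] is a monoid morphism from [G2^{*i}] to [G1^{*i}], injective because
   [G2^{*i}] acts faithfully on itself, hence bijective by counting; such a
   map restricts to an isomorphism of groups and fixes the adjoined
   idempotents. Two bimodule isomorphisms differ by right multiplication by a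
   unit of [G1^{*i}], that is [e_i] if [i > 0] and any element of [G1] if
   [i = 0]. *)
Require Import Defs.
From HB Require Import structures.
From mathcomp Require Import all_boot all_fingroup.
From mathcomp Require Import classical_sets functions.

Local Open Scope group_scope.

(** * Arithmetic of the monoids $G^{*k}$ and their ideals *)

HB.instance Definition _ (G : finGroupType) (k : nat) :=
  Finite.copy (gstar G k) (can_type (@sum_of_gstarK G k)).

Lemma card_gstar (G : finGroupType) (k : nat) : #|{: gstar G k}| = (#|G| + k)%N.
Proof.
rewrite -[k in RHS]card_ord -card_sum; apply: (bij_eq_card (f := @sum_of_gstar G k)).
by exists (@gstar_of_sum G k) => -[].
Qed.

Lemma gstarME (G : groupType) (k : nat) (x y : gstar G k) : x * y = gstar_mul x y.
Proof. by []. Qed.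

Lemma gstarS_one (G : groupType) (k : nat) : 1 = GIdem ord_max :> gstar G k.+1.
Proof.
have -> : 1 = gidem G (lift ord0 ord_max) :> gstar G k.+1.
  by congr gidem; apply: val_inj.
by rewrite /gidem liftK.
Qed.

(** A product with a factor in $G$ lies in $G$; otherwise its index is a minimum, which is maximal
    only if both indices are. *)
Lemma gstarS_unit (G : groupType) (k : nat) (x y : gstar G k.+1) :
  x * y = 1 -> x = 1.
Proof.
rewrite gstarS_one; case: x y => [g|j] [h|l] //=.
move/(congr1 (fun z => if z is GIdem m then val m else 0)) => /= Ek.
have le_kj : (k <= j)%N by have := geq_minl j l; rewrite Ek.
by congr GIdem; apply/val_inj/eqP; rewrite eqn_leq -ltnS ltn_ord.
Qed.

Lemma gstar0_elt {G : groupType} (x : gstar G 0) : exists g, x = GElt g.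
Proof. by case: x => [g|[]//]; exists g. Qed.

(** Associativity applied to [x * 1]. It replaces any [b] by an element of $G^{*i}$ with the same
    effect on the ideal. *)
Lemma gstar_ractE (G : groupType) (k i : nat) (x : gstar G i) (b : gstar G k) :
  gstar_ract x b = x * gstar_ract 1 b.
Proof.
rewrite -{1}[x]mulg1; case: (1 : gstar G i) x b => [g|j] [h|l] [a|m] //=.
  by rewrite !gstarME /= mulgA.
by rewrite !gstarME; congr GIdem; apply: val_inj; rewrite /= minnCA.
Qed.

Lemma gstar_map_morph (G H : groupType) (f : G -> H) (k : nat) :
  {morph f : x y / x * y} -> {morph @gstar_map G H f k : x y / x * y}.
Proof. by move=> fM [g|j] [h|l] //; rewrite !gstarME /= fM. Qed.

Lemma gstar_lact_incl {G : groupType} {k i : nat} (leik : (i <= k)%N)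
    (x y : gstar G i) : gstar_lact (gstar_incl leik x) y = x * y.
Proof.
by case: x y => [g|j] [h|l] //; rewrite gstarME; congr GIdem; apply: val_inj.
Qed.

Lemma gstar_ract_incl (G : groupType) (k i : nat) (leik : (i <= k)%N)
    (x y : gstar G i) : gstar_ract x (gstar_incl leik y) = x * y.
Proof.
case: x y => [g|j] [h|l] //; rewrite gstarME; congr GIdem.
by apply: val_inj; rewrite /= minnC.
Qed.

Lemma gstar_incl_morph (G : groupType) (k i : nat) (leik : (i <= k)%N) :
  {morph @gstar_incl G i k leik : x y / x * y}.
Proof. by move=> x y; rewrite -gstar_incl_lact (gstar_lact_incl leik). Qed.

(** * Injective morphisms between the monoids $G^{*k}$ *)

(** Since $j \le l$ means that the minimum is $j$, [s] preserves the order. Being bijective, it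
    preserves the number of elements below $j$, which is $j$. *)
Lemma min_morph_inj_id (k : nat) (s : 'I_k -> 'I_k) :
  injective s -> {morph s : j l / min_ord j l} -> s =1 id.
Proof.
move=> s_inj sM.
have s_leq : {mono s : j l / (j <= l)%N}.
  have E (a b : 'I_k) : (a <= b)%N = (min_ord a b == a).
    by rewrite -val_eqE /= (sameP minn_idPl eqP).
  by move=> j l; rewrite !E -sM (inj_eq s_inj).
have card_lt (j : 'I_k) : #|[pred l : 'I_k | (l < j)%N]| = j.
  rewrite -[RHS](card_ord j) -(card_codom (f := widen_ord (ltnW (ltn_ord j)))).
    apply: eq_card => l; apply/idP/codomP => [lt_lj|[m ->]]; last exact: (ltn_ord m).
    by exists (Ordinal lt_lj); apply: val_inj.
  by move=> a b /(congr1 val) /= /val_inj.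
move=> j; apply: val_inj; rewrite -[LHS]card_lt -[RHS]card_lt.
rewrite -[RHS](card_image s_inj); apply: eq_card => l.
have [s' s'K sK] := injF_bij s_inj.
by rewrite -[l]sK fintype.mem_image // !inE !ltnNge s_leq.
Qed.

(* [r (e_0)] lies in [H]: if [r b = e_0] then [e_0 b] lies in [G], and
   [r (e_0 b) = r (e_0) e_0] lies in the ideal [H]. *)
Lemma gstar_inj_morph {G H : finGroupType} {k : nat}
    {r : gstar G k -> gstar H k} :
  #|G| = #|H| -> injective r -> {morph r : x y / x * y} ->
  exists f : {morphism [set: G]%SET >-> H},
    isom [set: G] [set: H] f /\ r =1 @gstar_map G H f k.
Proof.
move=> eqGH r_inj rM.
have [r' r'K rK] : bijective r by apply: inj_card_bij => //; rewrite !card_gstar eqGH.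
have r_elt1 : exists h, r (GElt 1) = GElt h.
  have : exists g h, r (GElt g) = GElt h.
    case E: (r' (GElt 1)) => [g|j].
      by exists g, 1; rewrite -E rK.
    have := rM (GElt 1) (r' (GElt 1)); rewrite rK E => Er.
    exists 1; move: Er; rewrite gstarME /= => ->.
    by case: (r _) => [h|l]; [exists (h * 1) | exists 1].
  (* The ideal $H$ contains [r] of some $g$ in $G$, hence also $r(e_0) = r(g) r(g^{-1})$. *)
  case=> g [h Eh]; have := rM (GElt g) (GElt g^-1).
  rewrite Eh [X in r X]gstarME /= mulgV => ->.
  by case: (r _) => [h'|l]; [exists (h * h') | exists h].
have r_elt g : exists h, r (GElt g) = GElt h.
  have [h1 E1] := r_elt1; have := rM (GElt g) (GElt 1).
  rewrite E1 [X in r X]gstarME /= mulg1 => ->.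
  by case: (r _) => [h'|l]; [exists (h' * h1) | exists h1].
have [f Ef] := fin_all_exists r_elt.
have f_inj : injective f.
  move=> g h Efgh; have [] // : GElt g = GElt h :> gstar G k.
  by apply: r_inj; rewrite !Ef Efgh.
have fM : {in [set: G] &, {morph f : x y / x * y}}.
  move=> g h _ _; have := rM (GElt g) (GElt h).
  by rewrite !Ef gstarME => -[].
have injmf : 'injm (Morphism fM) by apply/injmP => g h _ _ /f_inj.
(* By counting, [f] already covers all of $H$, so by injectivity no other element is sent there. *)
have r_idem j : exists l, r (GIdem j) = GIdem l.
  case E: (r (GIdem j)) => [h|l]; last by exists l.
  have [f' f'K fK] : bijective f by apply: inj_card_bij => //; rewrite eqGH.
  by have /r_inj : r (GIdem j) = r (GElt (f' h)) by rewrite Ef fK.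
have [s Es] := fin_all_exists r_idem.
have s_id : s =1 id.
  apply: min_morph_inj_id => [j l Ejl|j l].
    by have [] : GIdem j = GIdem l :> gstar G k by apply: r_inj; rewrite !Es Ejl.
  have := rM (GIdem j) (GIdem l).
  by rewrite !Es gstarME => -[].
exists (Morphism fM); split; last by move=> [g|j] /=; rewrite ?Ef ?Es ?s_id.
apply/isomP; split=> //; apply/eqP.
by rewrite eqEcard finset.subsetT /= card_injm ?cardsT ?eqGH.
Qed.

(** * Existence of the group isomorphism *)

Lemma set_bijTP (M L : Type) (S : set L) (psi : M -> L) :
  set_bij [set: M]%classic S psi <->
  [/\ forall x, S (psi x), injective psi & forall y, S y -> exists x, psi x = y].
Proof.
split=> [[fS inj sur]|[fS inj sur]]; split.
- by move=> x; apply: fS.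
- by move=> x y; apply: inj; rewrite in_setT.
- by move=> y /sur[x _ Ex]; exists x.
- by move=> x _; apply: fS.
- by move=> x y _ _; apply: inj.
- by move=> y /sur[x Ex]; exists x.
Qed.

Lemma isom_invE {G H : finGroupType} {f : {morphism [set: G]%SET >-> H}}
    (isof : isom [set: G] [set: H] f) : cancel f (isom_inv isof).
Proof. by move=> x; apply: (invmE (isom_inj isof)); rewrite inE. Qed.

Lemma isom_invK {G H : finGroupType} {f : {morphism [set: G]%SET >-> H}}
    (isof : isom [set: G] [set: H] f) : cancel (isom_inv isof) f.
Proof.
by move=> x; apply: (invmK (isom_inj isof)); rewrite (isom_im isof) inE.
Qed.

Lemma unigen_iso_through (G1 G2 : finGroupType) (k1 k2 i : nat)
    (hi : (i <= minn k1 k2)%N) (L : bimodule (gstar G1 k1) (gstar G2 k2)) :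
  unigen i L -> exists phi : {morphism [set: G1]%SET >-> G2}, iso_through i L phi.
Proof.
have [lei1 lei2] : (i <= k1)%N /\ (i <= k2)%N by apply/andP; rewrite -leq_min.
case=> _ [psi1 [bij1 lin1]] [psi2 [/set_bijTP[S2 inj2 sur2] lin2]].
have /set_bijTP[S1 inj1 sur1] := bij1.
have psi12 x : exists z, psi2 z = psi1 x by apply: sur2.
have psi21 z : exists x, psi1 x = psi2 z by apply: sur1.
have eqG : #|G2| = #|G1|.
  have [s Es] := fin_all_exists psi12; have [t Et] := fin_all_exists psi21.
  apply/eqP; rewrite -(eqn_add2r i) -!card_gstar eqn_leq.
  rewrite (leq_card t); last by move=> x y Exy; apply: inj2; rewrite -!Et Exy.
  by rewrite (leq_card s) // => x y Exy; apply: inj1; rewrite -!Es Exy.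
have rho_ex (b : gstar G2 i) :
    exists a, psi1 a = Defs.ract (psi1 1) (gstar_incl lei2 b).
  by have [z <-] := psi12 1; rewrite -lin2; apply: sur1.
have [rho Erho] := fin_all_exists rho_ex.
have rhoE x b : psi1 (x * rho b) = Defs.ract (psi1 x) (gstar_incl lei2 b).
  rewrite -(gstar_lact_incl lei1) lin1 Erho lractA -lin1.
  by rewrite gstar_lact_incl mulg1.
(* Faithfulness is tested at the point [psi2 1] of $L_i$, which [b] sends to [psi2 b]. *)
have rho_inj : injective rho.
  move=> b c Ebc; have [x Ex] := psi21 1.
  have := rhoE x b; rewrite Ebc rhoE Ex -!lin2 !gstar_ract_incl !mul1g.
  by move/inj2.
have rhoM : {morph rho : b c / b * c}.
  move=> b c; apply: inj1.
  by rewrite rhoE !Erho gstar_incl_morph Defs.ractM.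
have [f [isof Ef]] := gstar_inj_morph eqG rho_inj rhoM.
(* [f] goes from $G_2$ to $G_1$, so the required isomorphism is its inverse. *)
have isophi := isom_sym isof.
exists [morphism of isom_inv isof], isophi, psi1; split; split=> // x b.
have invE : isom_inv isophi =1 f.
  by move=> g; rewrite -[g in LHS](isom_invE isof) (isom_invE isophi).
(* [rho] is defined on $G_2^{*i}$ only, so [b] is first replaced by its image there. That both act
   alike on $L_i$ is then seen through [psi2]. *)
have -> : ract_through isophi x b = x * rho (gstar_ract 1 b).
  rewrite /ract_through gstar_ractE gstar_map_morph; last first.
    by move=> g h; rewrite !invE morphM ?inE.
  rewrite Ef; congr (_ * _).
    by case: x => //= g; rewrite isom_invE.
  by case: (gstar_ract _ _) => //= g; rewrite invE.
rewrite rhoE; have [z <-] := psi12 x.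
by rewrite -!lin2 gstar_ract_incl -gstar_ractE.
Qed.

(** * Comparison of two group isomorphisms *)

Lemma iso_through_ract {G1 G2 : finGroupType} (k2 : nat) {i : nat}
    {phi : {morphism [set: G1]%SET >-> G2}}
    (isophi : isom [set: G1] [set: G2] phi) (x : gstar G1 i) (y : G1) :
  ract_through (k2 := k2) isophi x (GElt (phi y)) = x * GElt y.
Proof.
case: x => [g|j]; rewrite gstarME /ract_through /=; last by rewrite isom_invE.
by rewrite -morphM ?inE // isom_invE.
Qed.

(** [u] and [v] are the images of 1 under the transition maps between the two bimodule isomorphisms.
    The left action of [x] and the right action of [phi' x] agree on [psi' 1 = psi u]; reading both
    through [psi] gives the last equation. *)
Lemma iso_through_unit {G1 G2 : finGroupType} {k1 k2 i : nat}
    (hi : (i <= minn k1 k2)%N) {L : bimodule (gstar G1 k1) (gstar G2 k2)}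
    {phi phi' : {morphism [set: G1]%SET >-> G2}} :
  iso_through i L phi -> iso_through i L phi' ->
  exists u v : gstar G1 i, u * v = 1 /\
    forall x, exists2 y, phi' x = phi y & GElt x * u = u * GElt y.
Proof.
have lei1 : (i <= k1)%N by move: hi; rewrite leq_min => /andP[].
case=> iso [psi [[/set_bijTP[S1 inj sur] lin] [_ rlin]]].
case=> iso' [psi' [[/set_bijTP[S1' inj' sur'] lin'] [_ rlin']]].
have [u Eu] := sur _ (S1' 1); have [v Ev] := sur' _ (S1 1).
have linM x y : psi (x * y) = lact (gstar_incl lei1 x) (psi y).
  by rewrite -lin gstar_lact_incl.
have linM' x y : psi' (x * y) = lact (gstar_incl lei1 x) (psi' y).
  by rewrite -lin' gstar_lact_incl.
exists u, v; split.
  by apply: inj'; rewrite linM' Ev -linM mulg1.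
move=> x; exists (isom_inv iso (phi' x)); first by rewrite isom_invK.
apply: inj; rewrite -(iso_through_ract k2 iso) isom_invK.
by rewrite rlin Eu -rlin' iso_through_ract mul1g linM Eu -linM' mulg1.
Qed.

(** Let $a$ in $G_1$ correspond to $g$. Right multiplication by $a$ is a bijection of $G_1 =
    G_1^{*0}$ that commutes with the left action, and $x y a = x a y^a$ shows that composing [psi]
    with it turns [phi] into [phi']. *)
Lemma iso_through0_conj (G1 G2 : finGroupType) (k1 k2 : nat)
    (L : bimodule (gstar G1 k1) (gstar G2 k2))
    (phi phi' : {morphism [set: G1]%SET >-> G2}) (g : G2) :
  iso_through 0 L phi -> (forall x, phi' x = phi x ^ g) -> iso_through 0 L phi'.
Proof.
case=> iso [psi [[/set_bijTP[S1 inj sur] lin] [_ rlin]]] Ephi'.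
pose a := isom_inv iso g.
have {}Ephi' x : phi' x = phi (x ^ a).
  by rewrite Ephi' morphJ ?inE // isom_invK.
have inj_phi' : injective phi'.
  by move=> x y; rewrite !Ephi' => /(can_inj (isom_invE iso))/conjg_inj.
have iso' : isom [set: G1] [set: G2] phi'.
  have injm' : 'injm phi' by apply/injmP => x y _ _ /inj_phi'.
  apply/isomP; split=> //; apply/eqP.
  by rewrite eqEcard finset.subsetT /= card_injm ?(isom_card iso).
exists iso', (fun x => psi (x * GElt a)).
have bij' : set_bij [set: gstar G1 0]%classic (@unigen_part G1 G2 k1 k2 0 L)
    (fun x => psi (x * GElt a)).
  apply/set_bijTP; split=> [x|x y /inj|y /sur[x <-]] //.
    by case: x y => [x|[]//] [y|[]//] [] /mulIg ->.
  case: x => [x|[]//]; exists (GElt (x * a^-1)).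
  by rewrite gstarME /= mulgKV.
split; split=> //; [move=> c x | move=> x c].
  rewrite -lin; congr psi.
  by case: c x => [c|c] [x|[]//]; rewrite !gstarME //= mulgA.
rewrite -rlin; congr psi; case: c => [c|j]; last first.
  by case: x => [x|[]//]; rewrite /ract_through !gstarME /= !isom_invE.
rewrite -[c in RHS](isom_invK iso) iso_through_ract.
have -> : c = phi' (isom_inv iso c ^ a^-1) by rewrite Ephi' conjgKV isom_invK.
rewrite iso_through_ract Ephi' conjgKV isom_invE.
by case: x => [x|[]//]; rewrite !gstarME /= conjgE invgK !mulgA mulgKV.
Qed.

Theorem lemma1p2 (G1 G2 : finGroupType) (k1 k2 i : nat)
    (hi : (i <= minn k1 k2)%N)
    (L : bimodule (gstar G1 k1) (gstar G2 k2))
    (hL : unigen i L) :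
  [/\ exists phi : {morphism [set: G1]%SET >-> G2}, iso_through i L phi,
      (0 < i)%N ->
        forall phi phi' : {morphism [set: G1]%SET >-> G2},
          iso_through i L phi -> iso_through i L phi' -> phi =1 phi' &
      i = 0%N ->
        forall phi phi' : {morphism [set: G1]%SET >-> G2},
          iso_through i L phi ->
          (iso_through i L phi' <->
             exists g : G2, forall x : G1, phi' x = phi x ^ g)].
Proof.
split; first exact: unigen_iso_through.
(* For $i > 0$ the unit [u] is 1, so $x u = u y$ gives $x = y$. *)
- case: i hi {hL} => // i hi _ phi phi' isophi isophi' x.
  have [u [v [/gstarS_unit-> /(_ x)[y ->]]]] :=
    iso_through_unit hi isophi isophi'.
  by rewrite mulg1 mul1g => -[->].
- move=> i0; subst i => phi phi' isophi; split=> [isophi'|[g]]; last first.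
    exact: iso_through0_conj.
  have [u [_ [_ Eu]]] := iso_through_unit hi isophi isophi'.
  (* For $i = 0$ the unit [u] is some $g$ in $G_1$, and $x g = g y$ means $y = x^g$. *)
  have [g Eg] := gstar0_elt u; exists (phi g) => x.
  have [y -> ] := Eu x; rewrite Eg !gstarME /= => -[Exy].
  by rewrite -morphJ ?inE // conjgE Exy mulKg.
Qed.
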